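(* Let $K\in\mathcal{B}(\mathcal{H})$ and let $(\Phi,\Psi)=(\{\Phi_i\}_{i\in I},\{\Psi_i\}_{i\in I})$, with $\Phi_i,\Psi_i\in\mathcal{B}(\mathcal{H},\mathcal{K}_i)$ for all $i\in I$, be a bi-$g$-frame for $\mathcal{H}$ with respect to $\{\mathcal{K}_i\}_{i\in I}$, with bi-$g$-frame operator $S_{\Phi,\Psi}$. Then $(\Phi,\Psi)$ is a $K$-bi-$g$-frame for $\mathcal{H}$ with respect to $\{\mathcal{K}_i\}_{i\in I}$ if and only if there exists $A>0$ such that $S_{\Phi,\Psi}\ge A\,KK^{*}$.
   Context: $\mathcal{H}$ is a separable Hilbert space, $I$ is a finite or countable index set, and $\{\mathcal{K}_i\}_{i\in I}$ is a sequence of closed subspaces of $\mathcal{H}$. $\mathcal{B}(\mathcal{H},\mathcal{K})$ is the set of bounded linear operators $\mathcal{H}\to\mathcal{K}$, and $\mathcal{B}(\mathcal{H})=\mathcal{B}(\mathcal{H},\mathcal{H})$. A pair $(\{\Phi_i\}_{i\in I},\{\Psi_i\}_{i\in I})$ with $\Phi_i,\Psi_i\in\mathcal{B}(\mathcal{H},\mathcal{K}_i)$ is a bi-$g$-frame for $\mathcal{H}$ with respect to $\{\mathcal{K}_i\}_{i\in I}$ if there exist constants $0<A\le B<\infty$ such that $A\|x\|^2\le\sum_{i\in I}\langle\Phi_i x,\Psi_i x\rangle\le B\|x\|^2$ for all $x\in\mathcal{H}$. For $K\in\mathcal{B}(\mathcal{H})$, the pair is a $K$-bi-$g$-frame for $\mathcal{H}$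 with respect to $\{\mathcal{K}_i\}_{i\in I}$ if there exist constants $0<A\le B<\infty$ such that $A\|K^{*}x\|^2\le\sum_{i\in I}\langle\Phi_i x,\Psi_i x\rangle\le B\|x\|^2$ for all $x\in\mathcal{H}$. The bi-$g$-frame operator is $S_{\Phi,\Psi}:\mathcal{H}\to\mathcal{H}$, $S_{\Phi,\Psi}x=\sum_{i\in I}\Psi_i^{*}\Phi_i x$. For operators, $S\ge T$ means $\langle Sx,x\rangle\ge\langle Tx,x\rangle$ for all $x\in\mathcal{H}$. *)

(* Defs.v *)
From HB Require Import structures.
From mathcomp Require Import all_boot all_order all_algebra.
From mathcomp Require Import sesquilinear complex.
From mathcomp Require Import boolp classical_sets functions cardinality reals.
From mathcomp Require Import topology normedtype.
From mathcomp.analysis.showcase Require Import summability.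

Set Implicit Arguments.
Unset Strict Implicit.
Unset Printing Implicit Defensive.

Import Order.TTheory GRing.Theory Num.Theory.
Import numFieldNormedType.Exports.

Local Open Scope classical_set_scope.
Local Open Scope ring_scope.
Local Open Scope complex_scope.

(* Complex Hilbert spaces. The inner product is linear in its first argument
   and conjugate-linear in its second one; completeness is that of the
   underlying normed module. The norm of a module over R[i] is R[i]-valued. *)
HB.mixin Record isHilbert (R : realType) H & CompleteNormedModule R[i] H := {
  hdot : {dot H for (@Num.conj R[i])};
  hdot_norm : forall x : H, `|x| ^+ 2 = hdot x x
}.

#[short(type="hilbertType")]
HB.structure Definition Hilbert (R : realType) :=
  {H of isHilbert R H & CompleteNormedModule R[i] H}.

Section Hilbert.
Context {R : realType} {H : hilbertType R}.

Definition separable := exists2 D : set H, countable D & dense D.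

Definition closed_subspace (L : set H) :=
  closed L /\ submod_closed (mem L : {pred H}).

(* B(H, L), for L a closed subspace of H: the inclusion L -> H is isometric, so
   a bounded operator from H to L is one from H to H with values in L. *)
Record bounded_op (L : set H) := BoundedOp {
  bounded_op_fun :> {linear H -> H};
  bounded_op_bounded : exists M : R, forall x, `|bounded_op_fun x| <= M%:C * `|x|;
  bounded_op_range : forall x, L (bounded_op_fun x)
}.

(* For T in B(H, L), adjoint T restricted to L is the adjoint T^* : L -> H,
   the inner product of L being that of H. The vector z is unique, and it exists
   by the Riesz representation theorem. *)
Definition adjoint (L : set H) (T : bounded_op L) (y : H) : H :=
  xget 0 [set z : H | forall x, hdot (T x) y = hdot x z].

Definition op_ge (S T : H -> H) := forall x, hdot (T x) x <= hdot (S x) x.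

(* The index set carries no order: all sums over I are unordered, i.e., limits
   of the finite partial sums along the directed set of finite subsets of I. *)
Context {I : countType} {L : I -> set H}.
Implicit Types Phi Psi : forall i, bounded_op (L i).

Definition frame_term Phi Psi (x : H) (i : I) : R[i]^o :=
  hdot (Phi i x) (Psi i x).

(* An inequality between elements of R[i] entails that their difference is
   real, so that the sums below are real. *)
Definition bi_g_frame Phi Psi := exists A B : R,
  [/\ 0 < A, A <= B & forall x : H,
    cvg (partial_sum (frame_term Phi Psi x) @ totally) /\
    A%:C * `|x| ^+ 2 <= sum (frame_term Phi Psi x) <= B%:C * `|x| ^+ 2].

Definition K_bi_g_frame (K : bounded_op [set: H]) Phi Psi := exists A B : R,
  [/\ 0 < A, A <= B & forall x : H,
    cvg (partial_sum (frame_term Phi Psi x) @ totally) /\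
    A%:C * `|adjoint K x| ^+ 2 <= sum (frame_term Phi Psi x)
      <= B%:C * `|x| ^+ 2].

Definition bi_g_frame_op Phi Psi (x : H) : H :=
  sum (fun i => adjoint (Psi i) (Phi i x)).

End Hilbert.

Arguments separable {R} H.

(* Main.v *)
Require Import Defs.
From mathcomp Require Import all_boot all_order all_algebra.
From mathcomp Require Import finmap sesquilinear complex ring lra.
From mathcomp Require Import boolp classical_sets reals.
From mathcomp Require Import topology normedtype sequences.
From mathcomp.analysis.showcase Require Import summability.

(** Once the frame operator S is known to make sense, the theorem is a
    computation: <S x, x> is the frame sum of <Phi_i x, Psi_i x>, and
    <A K K^* x, x> = A |K^* x|^2, so that the inequality S >= A K K^* is the
    lower K-bi-g-frame bound. The upper bound and the convergence of the frame
    sums come from the bi-g-frame hypothesis, with the upper constant enlarged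
    to Num.max A B to keep it above A.

    The substance is that the vectors Psi_i^* (Phi_i x) are summable in norm,
    whereas the hypothesis only speaks of the scalar sums of <Phi_i x, Psi_i x>.
    Polarization (hdot_polarization) turns it into a statement on all pairs
    x, y: the finite partial sums of <Psi_i^* Phi_i x, y> are bounded, for each
    y, because convergent unordered sums have bounded partial sums. The
    uniform boundedness principle (rdot_uniform_bound) then bounds the finite
    partial sums in norm, and in a Hilbert space such a family is summable
    (weakly_bounded_cvg, a case of the Orlicz-Pettis and Bessaga-Pelczynski
    theorems): were it not Cauchy, there would be arbitrarily many disjoint
    blocks of norm at least e, and adding or subtracting each of them so as to
    make an angle of at most 90 degrees with the sum already built would produce
    vectors of norm at least e sqrt(n), against the bound.

    Riesz representation (rdot_riesz) makes the adjoints what they should be. It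
    is obtained by minimizing |x|^2 - 2 g x, for g a bounded real linear form.
    Most arguments use only the real inner product Re <x, y>, which determines
    the complex one because Im <x, y> = Re <- i x, y>. *)

Import Order.TTheory GRing.Theory Num.Theory.
Import numFieldNormedType.Exports.

Local Open Scope classical_set_scope.
Local Open Scope ring_scope.
Local Open Scope complex_scope.

(** * The real inner product of a complex Hilbert space *)

Section RealInnerProduct.
Context {R : realType} {H : hilbertType R}.
Implicit Types (x y z : H) (a : R).

Definition rdot x y : R := complex.Re (hdot x y).

(** The norm of H takes its values in R[i]; this is the same norm, read in R. *)
Definition rnorm x : R := complex.Re `|x|.

Lemma rnormE x : `|x| = (rnorm x)%:C.
Proof. by rewrite /rnorm RRe_real// ger0_real. Qed.

Lemma hdotC x y : hdot x y = (hdot y x)^*%C.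
Proof. by have := hermC (@hdot R H) x y; rewrite expr0 mul1r. Qed.

Lemma rdotC x y : rdot x y = rdot y x.
Proof. by rewrite /rdot hdotC; case: (hdot y x). Qed.

Lemma rdotDl x y z : rdot (x + y) z = rdot x z + rdot y z.
Proof. by rewrite /rdot linearDl raddfD. Qed.

Lemma rdotBl x y z : rdot (x - y) z = rdot x z - rdot y z.
Proof. by rewrite /rdot linearBl raddfB. Qed.

Lemma rdotZl a x y : rdot (a%:C *: x) y = a * rdot x y.
Proof.
rewrite /rdot linearZl_LR/=; case: (hdot x y) => u v /=.
by rewrite mul0r subr0.
Qed.

Lemma rdotDr x y z : rdot x (y + z) = rdot x y + rdot x z.
Proof. by rewrite ![rdot x _]rdotC rdotDl. Qed.

Lemma rdotBr x y z : rdot x (y - z) = rdot x y - rdot x z.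
Proof. by rewrite ![rdot x _]rdotC rdotBl. Qed.

Lemma rdotZr a x y : rdot x (a%:C *: y) = a * rdot x y.
Proof. by rewrite ![rdot x _]rdotC rdotZl. Qed.

Lemma conj_i : Num.conj 'i%C = - 'i%C :> R[i].
Proof.
by apply/eqP; rewrite -[eqbLHS]/('i%C^*%C) eq_complex /= oppr0 !eqxx.
Qed.

(** Reduces statements on hdot to statements on rdot. *)
Lemma Im_hdot x y : complex.Im (hdot x y) = rdot (- 'i%C *: x) y.
Proof.
rewrite /rdot linearZl_LR/=; case: (hdot x y) => u v /=.
by rewrite oppr0 mul0r sub0r mulN1r opprK.
Qed.

Lemma rnorm_ge0 x : 0 <= rnorm x.
Proof. by rewrite -ler0c -rnormE. Qed.

Lemma rnorm_distC x y : rnorm (x - y) = rnorm (y - x).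
Proof. by rewrite /rnorm distrC. Qed.

Lemma sqr_rnorm x : rnorm x ^+ 2 = rdot x x.
Proof. by rewrite /rdot -hdot_norm rnormE -rmorphXn. Qed.

Lemma rnormZ a x : rnorm (a%:C *: x) = `|a| * rnorm x.
Proof.
apply: complexI; rewrite -rnormE normrZ rnormE rmorphM/=; congr (_ * _).
by rewrite normc_def/= expr0n/= addr0 sqrtr_sqr.
Qed.

Lemma ler_rnormD x y : rnorm (x + y) <= rnorm x + rnorm y.
Proof. by rewrite -lecR rmorphD/= -!rnormE ler_normD. Qed.

Lemma rdot_ge0 x : 0 <= rdot x x.
Proof. by rewrite -sqr_rnorm sqr_ge0. Qed.

Lemma rdot_CauchySchwarz x y : `|rdot x y| <= rnorm x * rnorm y.
Proof.
rewrite -ler_sqr ?nnegrE ?mulr_ge0 ?rnorm_ge0// exprMn !sqr_rnorm.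
rewrite real_normK ?num_real//.
have [x0|x0] := eqVneq (rdot x x) 0.
  have /eqP : `|x| = 0.
    by rewrite rnormE; move/eqP: x0; rewrite -sqr_rnorm sqrf_eq0 => /eqP ->.
  rewrite normr_eq0 => /eqP ->.
  by rewrite /rdot !linear0l/= expr0n/= mul0r.
have xgt0 : 0 < rdot x x by rewrite lt_def x0 rdot_ge0.
(* Up to a factor, the component of y orthogonal to x. *)
have := rdot_ge0 ((rdot x x)%:C *: y - (rdot x y)%:C *: x).
rewrite !(rdotBl, rdotBr, rdotZl, rdotZr) (rdotC y x) => h.
have : 0 <= rdot x x * (rdot x x * rdot y y - rdot x y ^+ 2) by nra.
by rewrite pmulr_rge0// subr_ge0.
Qed.

(** The radii of balls are elements of R[i]: being positive, they are real. *)
Lemma cvg_rnormP (T : Type) (F : set_system T) {FF : Filter F} (f : T -> H) l :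
  f @ F --> l <-> forall e : R, 0 < e -> \forall t \near F, rnorm (l - f t) < e.
Proof.
split=> [/cvgrPdist_lt fl e e0|fl].
  have : 0 < e%:C by rewrite ltcR.
  by move=> /fl; apply: filterS => t; rewrite rnormE ltcR.
apply/cvgrPdist_lt => -[e ie]; rewrite ltcE /= => /andP[/eqP -> e0].
have := fl e e0; apply: filterS => t.
by rewrite rnormE ltcR.
Qed.

Lemma cauchy_rnorm_cvg (T : Type) (F : set_system T) {FF : ProperFilter F}
    (f : T -> H) :
  (forall e : R, 0 < e -> exists x, \forall t \near F, rnorm (x - f t) < e) ->
  cvg (f @ F).
Proof.
move=> fF; apply: cauchy_cvg; apply: cauchy_exP => -[e ie].
rewrite ltcE /= => /andP[/eqP -> e0].
have [x xf] := fF e e0; exists x; apply: filterS xf => t.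
by rewrite -ball_normE /ball_ /= rnormE ltcR.
Qed.

Lemma cvg_rdot (T : Type) (F : set_system T) {FF : Filter F} (f : T -> H) l x :
  f @ F --> l -> rdot x (f t) @[t --> F] --> rdot x l.
Proof.
move/cvg_rnormP => fl; apply/cvgrPdist_lt => e e0.
have n1 : 0 < rnorm x + 1 by rewrite ltr_wpDl ?rnorm_ge0.
have := fl (e / (rnorm x + 1)) (divr_gt0 e0 n1); apply: filterS => t.
rewrite ltr_pdivlMr// -rdotBr => h.
apply: le_lt_trans (rdot_CauchySchwarz _ _) _.
by have := rnorm_ge0 (l - f t); nra.
Qed.

End RealInnerProduct.

(** * Riesz representation and adjoints *)

Section Riesz.
Context {R : realType} {H : hilbertType R}.
Implicit Types (x y z : H) (a : R).

(** The representing vector is the minimizer of J x = |x|^2 - 2 g x: by the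
    parallelogram identity, near-minimizers of J are close to each other, so
    that they converge; and the first-order condition at the minimum, in the
    direction x, is g x = rdot x z. *)
Lemma rdot_riesz (g : H -> R) (M : R) :
  (forall x y, g (x + y) = g x + g y) ->
  (forall a x, g (a%:C *: x) = a * g x) ->
  (forall x, `|g x| <= M * rnorm x) ->
  exists z, forall x, g x = rdot x z.
Proof.
move=> gD gZ gM.
pose J x := rdot x x - 2 * g x.
have J_lb x : - M ^+ 2 <= J x.
  have := gM x; rewrite ler_norml => /andP[_ gx].
  by rewrite /J -sqr_rnorm; have := sqr_ge0 (rnorm x - M); nra.
have infJ : has_inf (range J).
  by split; [exists (J 0), 0 | exists (- M ^+ 2) => _ [x _ <-]].
pose m := inf (range J).
have m_lb x : m <= J x by apply: ge_inf; [exact: infJ.2 | exists x].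
pose near_min e : set H := [set x | J x < m + e].
pose F := filter_from [set e : R | 0 < e] near_min.
have FF : ProperFilter F.
  apply: filter_from_proper.
    apply: filter_from_filter; first by exists 1 => /=.
    move=> e1 e2 /= e10 e20; exists (Num.min e1 e2).
      by rewrite /= lt_min e10.
    by move=> x; rewrite /near_min /= -ltrBlDl lt_min !ltrBlDl => /andP[].
  by move=> e /= e0; have [_ [x _ <-] Jx] := inf_adherent e0 infJ; exists x.
(* Compare J with its value at the midpoint of x and y. *)
have Jmid x y : rdot (x - y) (x - y) <= 2 * (J x - m) + 2 * (J y - m).
  have := m_lb (2^-1%:C *: (x + y)); rewrite /J gZ gD.
  rewrite !(rdotBl, rdotBr, rdotDl, rdotDr, rdotZl, rdotZr) (rdotC y x).
  lra.
have cF : cvg (id @ F).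
  apply: cauchy_rnorm_cvg => e e0.
  have e2 : 0 < e ^+ 2 / 4 by rewrite divr_gt0 ?exprn_gt0.
  have [_ [x _ <-] Jx] := inf_adherent e2 infJ; exists x.
  exists (e ^+ 2 / 4) => // y; rewrite /near_min /= => Jy.
  rewrite -ltr_sqr ?nnegrE ?rnorm_ge0 ?(ltW e0)// sqr_rnorm.
  by apply: le_lt_trans (Jmid x y) _; move: Jx; rewrite -/m; lra.
pose z := lim (id @ F); exists z => x.
apply: (@cvg_unique _ _ (rdot x y @[y --> F])); first exact: Rhausdorff.
  apply/cvgrPdist_lt => e e0.
  pose N := rdot x x + 1.
  have N0 : 0 < N by rewrite ltr_wpDl ?rdot_ge0.
  exists (e ^+ 2 / N); first by rewrite /= divr_gt0 ?exprn_gt0.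
  move=> y; rewrite /near_min /= => Jy.
  rewrite -ltr_sqr ?nnegrE ?normr_ge0 ?(ltW e0)// real_normK ?num_real//.
  (* t minimizes t |-> J (y + t x), up to N standing for |x|^2 + 1 to be
     nonzero. *)
  pose D := g x - rdot x y; pose t := D / N.
  have tN : t * N = D by rewrite /t divfK ?gt_eqF.
  have := m_lb (y + t%:C *: x); rewrite /J gD gZ.
  rewrite !(rdotDl, rdotDr, rdotZl, rdotZr) (rdotC y x) => mle.
  have DN : D ^+ 2 / N = t * D by rewrite /t expr2 mulrAC.
  have NN : rdot x x = N - 1 by rewrite /N addrK.
  rewrite -/D -(ltr_pM2r (_ : 0 < N^-1)) ?invr_gt0// DN.
  have : m <= J y - 2 * t * D + t * (t * (N - 1)).
    by rewrite -NN /J /D; move: mle; lra.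
  have -> : t * (t * (N - 1)) = t * D - t ^+ 2 by rewrite -tN; ring.
  by have := sqr_ge0 t; move: Jy; lra.
exact: cvg_rdot.
Qed.

(** With Riesz representation, the choice made in the definition of adjoint does
    not fall back on its default value. *)
Lemma adjointP (L : set H) (T : bounded_op L) x y :
  hdot (T x) y = hdot x (adjoint T y).
Proof.
have [M TM] := bounded_op_bounded T.
have [||x'|z gz] := @rdot_riesz (fun x => rdot (T x) y) (M * rnorm y).
- by move=> ? ?; rewrite linearD rdotDl.
- by move=> ? ?; rewrite linearZ rdotZl.
- apply: le_trans (rdot_CauchySchwarz _ _) _.
  rewrite mulrAC ler_wpM2r ?rnorm_ge0//.
  by have := TM x'; rewrite !rnormE -rmorphM lecR.
rewrite /adjoint; case: xgetP => [_ _ -> //|/(_ z)[]] w.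
apply/eqP; rewrite eq_complex -!/(rdot _ _) !Im_hdot -gz eqxx /=.
by rewrite -linearZ -gz.
Qed.

Lemma hdot_adjoint (L : set H) (T : bounded_op L) x y :
  hdot (adjoint T y) x = hdot y (T x).
Proof. by rewrite hdotC -adjointP -hdotC. Qed.

End Riesz.

(** * Uniform boundedness *)

Section UniformBoundedness.
Context {R : realType} {H : hilbertType R}.

(** Gliding hump: were W unbounded, choose w_n in W of norm more than n 3^n, and
    move from 0 by successive steps of length 3^-n along w_n, in the direction
    that increases |rdot w_n|. The steps after the n-th one add up to at most
    half of the n-th one, hence |rdot w_n l| > n / 2 at the limit l. *)
Lemma rdot_uniform_bound (W : set H) :
  (forall y, exists C : R, forall w, W w -> `|rdot w y| <= C) ->
  exists M : R, forall w, W w -> rnorm w <= M.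
Proof.
move=> Wb; apply: contrapT => unbounded.
have large (M : R) : exists w, W w /\ M < rnorm w.
  apply: contrapT => small; apply: unbounded; exists M => w Ww.
  by rewrite leNgt; apply/negP => Mw; apply: small; exists w.
pose q n : R := (3^-1) ^+ n.
have q_gt0 n : 0 < q n by rewrite exprn_gt0// invr_gt0.
have qS n : q n.+1 = q n / 3 by rewrite /q exprSr.
have [w ww] := choice (fun n : nat => large (n%:R / q n)).
have w_gt0 n : 0 < rnorm (w n).
  by apply: le_lt_trans (ww n).2; rewrite divr_ge0 ?(ltW (q_gt0 _)).
pose s n y : R := (if 0 <= rdot (w n) y then 1 else - 1) * (q n / rnorm (w n)).
pose fix hump n : H :=
  if n is n'.+1 then hump n' + (s n' (hump n'))%:C *: w n' else 0.
have stepE n : rnorm (hump n.+1 - hump n) = q n.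
  rewrite /= addrAC subrr add0r rnormZ normrM [X in X * _ * _](_ : _ = 1).
    by rewrite mul1r gtr0_norm ?divr_gt0// divfK ?gt_eqF.
  by case: ifP; rewrite ?normrN normr1.
have peak n : q n * rnorm (w n) <= `|rdot (w n) (hump n.+1)|.
  rewrite /= rdotDr rdotZr -sqr_rnorm /s.
  have -> : forall b : R, b * (q n / rnorm (w n)) * rnorm (w n) ^+ 2 =
      b * (q n * rnorm (w n)).
    by move=> b; rewrite expr2 mulrA -(mulrA b) divfK ?gt_eqF// mulrA.
  have : 0 < q n * rnorm (w n) by rewrite mulr_gt0.
  case: (lerP 0 (rdot (w n) (hump n))) => h p.
    by rewrite mul1r ger0_norm; lra.
  by rewrite mulN1r ltr0_norm; lra.
have tail n k : rnorm (hump (n + k)%N - hump n) <= 3 / 2 * (q n - q (n + k)%N).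
  elim: k => [|k IH].
    by rewrite addn0 !subrr mulr0 /rnorm normr0.
  rewrite addnS -[_ - _](subrKA (hump (n + k))).
  apply: le_trans (ler_rnormD _ _) _; rewrite stepE qS.
  by move: IH; lra.
have tail_lt n k : rnorm (hump (n + k)%N - hump n) < 3 / 2 * q n.
  by apply: le_lt_trans (tail n k) _; have := q_gt0 (n + k)%N; lra.
have qcvg : q @ \oo --> 0 by apply: cvg_expr; rewrite ger0_norm; lra.
have hcvg : cvg (hump @ \oo).
  apply: cauchy_rnorm_cvg => e e0.
  have e1 : 0 < e * 2 / 3 by lra.
  have [n _ /(_ n (leqnn n))] := proj1 (cvgrPdist_lt _ _) qcvg _ e1.
  rewrite /= sub0r normrN gtr0_norm// => qn.
  exists (hump n); exists n => // k /= nk; rewrite rnorm_distC -(subnKC nk).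
  by have := tail_lt n (k - n)%N; move: qn; lra.
pose l := lim (hump @ \oo).
have ltail n : rnorm (l - hump n) <= 3 / 2 * q n.
  rewrite leNgt; apply/negP => lt.
  have e0 : 0 < rnorm (l - hump n) - 3 / 2 * q n by lra.
  have /cvg_rnormP/(_ _ e0)[k _ /(_ _ (leq_addl n k))/= hk] :=
    (hcvg : hump @ \oo --> l).
  have := ler_rnormD (l - hump (n + k)%N) (hump (n + k)%N - hump n).
  by rewrite subrKA; have := tail_lt n k; lra.
have [C lC] := Wb l.
have C_ge0 : 0 <= C by apply: le_trans (lC _ (ww 0%N).1).
pose n := (Num.truncn (2 * C)).+1.
have nC : 2 * C < n%:R by rewrite truncnS_gt.
have := ltail n.+1; rewrite qS => ln.
have := rdot_CauchySchwarz (w n) (l - hump n.+1); rewrite rdotBr => dist.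
have := lC _ (ww n).1; have := peak n.
have := (ww n).2; rewrite ltr_pdivrMr// => wn p lw.
have := ler_normB (rdot (w n) l) (rdot (w n) l - rdot (w n) (hump n.+1)).
rewrite opprB addrC subrK => tri.
have : rnorm (w n) * rnorm (l - hump n.+1) <= rnorm (w n) * (3 / 2 * (q n / 3)).
  by rewrite ler_wpM2l// ltW.
lra.
Qed.

End UniformBoundedness.

(** * Unordered sums *)

#[local] Existing Instance totally_filter.

Section UnorderedSums.
Local Open Scope fset_scope.
Local Open Scope ring_scope.
Context {I : choiceType}.

Lemma partial_sumE {V : zmodType} (f : I -> V) (A : {fset I}) :
  partial_sum f A = \sum_(i <- A) f i.
Proof. by rewrite /partial_sum -(big_seq_fsetE _ _ xpredT). Qed.

Lemma partial_sumU {V : zmodType} (f : I -> V) (A B : {fset I}) :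
  partial_sum f (A `|` B) = partial_sum f A + partial_sum f (B `\` A).
Proof.
rewrite !partial_sumE.
rewrite (big_fsetID _ (fun i => i \in A)) /=.
congr (_ + _); apply: eq_fbigl => i.
- by rewrite !inE /=; case: (i \in A); rewrite ?andbF.
- by rewrite !inE /=; case: (i \in A); rewrite ?andbF ?andbT.
Qed.

(** Beyond some A0, partial sums are at distance less than 1 of the limit; and a
    partial sum over A differs from that over the union of A and A0 by a sum
    over a part of A0. *)
Lemma cvg_partial_sum_bounded {K : numFieldType} {V : normedModType K}
    (f : I -> V) :
  cvg (partial_sum f @ totally) ->
  exists C : K, forall A, `|partial_sum f A| <= C.
Proof.
move=> /cvgrPdist_lt/(_ 1 ltr01)[A0 _ A0P].
set l := lim _ in A0P.
exists (`|l| + 1 + \sum_(i : A0) `|f (val i)|) => A.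
have -> : partial_sum f A = l - (l - partial_sum f (A `|` A0))
    - partial_sum f (A0 `\` A).
  by rewrite partial_sumU subKr addrK.
apply: le_trans (ler_normB _ _) _; apply: lerD.
  apply: le_trans (ler_normB _ _) _; rewrite lerD2l ltW//.
  by apply: A0P; rewrite /= fsubsetUr.
apply: le_trans (ler_norm_sum _ _ _) _.
rewrite -!(big_seq_fsetE _ _ xpredT (fun i => `|f i|))/=.
rewrite [leRHS](big_fsetID _ (fun i => i \in A0 `\` A))/=.
rewrite -[leLHS]addr0 lerD ?sumr_ge0//.
rewrite le_eqVlt; apply/orP; left; apply/eqP; apply: eq_fbigl => i.
by rewrite !inE/=; case: (i \in A0); rewrite ?andbF.
Qed.

End UnorderedSums.

Section WeaklyBoundedSums.
Local Open Scope fset_scope.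
Local Open Scope ring_scope.
Context {R : realType} {H : hilbertType R} {I : choiceType}.

(** By uniform boundedness, the partial sums have norm at most some M. If they
    were not Cauchy, there would always be a new finite block D, disjoint from
    those already used, whose sum has norm at least e. Give D the sign of its
    inner product with the current signed sum: this adds at least e^2 to the
    squared norm of the latter, which stays at most (2 M)^2. *)
Lemma weakly_bounded_cvg (v : I -> H) :
  (forall y, exists C : R, forall A, `|rdot (partial_sum v A) y| <= C) ->
  cvg (partial_sum v @ totally).
Proof.
move=> vb.
have [M vM] : exists M : R, forall A, rnorm (partial_sum v A) <= M.
  have [y|M WM] := @rdot_uniform_bound R H (range (partial_sum v)).
    by have [C yC] := vb y; exists C => _ [A _ <-].
  by exists M => A; apply: WM; exists A.
apply: cauchy_rnorm_cvg => e e0; apply: contrapT => Ncauchy.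
have block (A : {fset I}) :
    exists D, [disjoint A & D]%fset /\ e <= rnorm (partial_sum v D).
  apply: contrapT => small; apply: Ncauchy; exists (partial_sum v A).
  exists A => // B /= AB; rewrite ltNge; apply/negP => eB; apply: small.
  exists (B `\` A); split.
    by apply/fdisjointP => i iA; rewrite inE iA.
  suff <- : partial_sum v B - partial_sum v A = partial_sum v (B `\` A).
    by rewrite rnorm_distC.
  by rewrite -{1}(fsetUidPr _ _ AB) partial_sumU addrC addKr.
(* P and N gather the blocks counted with sign + and with sign -. *)
have grow (n : nat) : exists P N : {fset I},
    n%:R * e ^+ 2 <= rnorm (partial_sum v P - partial_sum v N) ^+ 2.
  elim: n => [|n [P [N IH]]].
    by exists fset0, fset0; rewrite mul0r sqr_ge0.
  have [D [PND eD]] := block (P `|` N).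
  have addD (A : {fset I}) : A `<=` P `|` N ->
      partial_sum v (A `|` D) = partial_sum v A + partial_sum v D.
    move=> APN; rewrite partial_sumU; congr (_ + partial_sum v _).
    by apply/fsetDidPl; rewrite fdisjoint_sym; exact: fdisjointWl APN PND.
  have eD2 : e ^+ 2 <= rdot (partial_sum v D) (partial_sum v D).
    by rewrite -sqr_rnorm ler_sqr ?nnegrE ?rnorm_ge0// ltW.
  move: IH eD2; rewrite -natr1 mulrDl mul1r sqr_rnorm.
  case: (lerP 0 (rdot (partial_sum v P - partial_sum v N) (partial_sum v D))).
    move=> h IH eD2; exists (P `|` D), N; rewrite addD ?fsubsetUl// addrAC.
    rewrite sqr_rnorm rdotDl !(rdotDr _ _ (partial_sum v D)).
    by rewrite (rdotC (partial_sum v D) (_ - _)); lra.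
  move=> h IH eD2; exists P, (N `|` D); rewrite addD ?fsubsetUr// opprD addrA.
  rewrite sqr_rnorm rdotBl !(rdotBr _ _ (partial_sum v D)).
  by rewrite (rdotC (partial_sum v D) (_ - _)); lra.
pose n := (Num.truncn ((2 * M) ^+ 2 / e ^+ 2)).+1.
have [P [N PN]] := grow n.
have : (2 * M) ^+ 2 < n%:R * e ^+ 2.
  by rewrite -ltr_pdivrMr ?exprn_gt0// truncnS_gt.
apply/negP; rewrite -leNgt; apply: le_trans PN _.
have M0 : 0 <= M by apply: le_trans (vM fset0); exact: rnorm_ge0.
rewrite ler_sqr ?nnegrE ?rnorm_ge0 ?mulr_ge0// mulr_natl mulr2n.
apply: le_trans (ler_rnormD _ _) _; rewrite lerD//.
by rewrite /rnorm normrN; exact: vM.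
Qed.

End WeaklyBoundedSums.

Section HdotSums.
Context {R : realType} {H : hilbertType R} {I : choiceType}.

Lemma ler_norm_ReIm (z : R[i]) : `|z| <= (`|complex.Re z| + `|complex.Im z|)%:C.
Proof.
rewrite normc_def lecR -ler_sqr ?nnegrE ?sqrtr_ge0 ?addr_ge0//.
rewrite sqr_sqrtr ?addr_ge0 ?sqr_ge0//.
rewrite -[complex.Re z ^+ 2]real_normK ?num_real//.
rewrite -[complex.Im z ^+ 2]real_normK ?num_real// sqrrD.
by rewrite lerD2r lerDl mulrn_wge0// mulr_ge0.
Qed.

Lemma sum_hdot (v : I -> H) x :
  cvg (partial_sum v @ totally) ->
  sum (fun i => hdot (v i) x : R[i]^o) = hdot (sum v) x.
Proof.
move=> vcvg; rewrite /sum (_ : partial_sum _ =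
    (fun A => hdot (partial_sum v A) x : R[i]^o)); last first.
  by apply/funext => A; rewrite /partial_sum linear_sumlz.
apply: cvg_lim; first exact: norm_hausdorff.
have Recvg y : rdot (partial_sum v A) y @[A --> totally] --> rdot (sum v) y.
  have -> : (fun A => rdot (partial_sum v A) y) =
      (fun A => rdot y (partial_sum v A)) by apply/funext => A; rewrite rdotC.
  by rewrite rdotC; apply: cvg_rdot.
have Imcvg : rdot (- 'i%C *: partial_sum v A) x @[A --> totally] -->
    rdot (- 'i%C *: sum v) x.
  have E u : rdot (- 'i%C *: u) x = rdot u ('i%C *: x).
    rewrite /rdot linearZl_LR linearZr_LR; congr (complex.Re (_ * _)).
    by rewrite conj_i.
  rewrite E; have -> : (fun A => rdot (- 'i%C *: partial_sum v A) x) =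
      (fun A => rdot (partial_sum v A) ('i%C *: x)) by apply/funext => A.
  exact: Recvg.
apply/cvgrPdist_lt => -[e ie]; rewrite ltcE /= => /andP[/eqP -> e0].
have e2 : 0 < e / 2 by rewrite divr_gt0.
near=> A.
apply: le_lt_trans (ler_norm_ReIm _) _; rewrite ltcR (splitr e) ltrD//.
  rewrite raddfB/=; near: A; exact: (proj1 (cvgrPdist_lt _ _) (Recvg x)).
rewrite raddfB/= !Im_hdot; near: A; exact: (proj1 (cvgrPdist_lt _ _) Imcvg).
Unshelve. all: by end_near.
Qed.

End HdotSums.

(** * The bi-g-frame operator *)

Section FrameOperator.
Context {R : realType} {H : hilbertType R}.

(** Replacing y by its multiples by 1, -1, i and -i singles out, in the
    expansion of q (x + y), the term that is linear in x and conjugate-linear in y. *)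
Lemma hdot_polarization (P Q : {linear H -> H}) x y :
  let q u := hdot (P u) (Q u) in
  4 * hdot (P x) (Q y) =
    q (x + y) - q (x - y) + 'i%C * (q (x + 'i%C *: y) - q (x - 'i%C *: y)).
Proof.
rewrite /= !linearD !linearN !linearZ_LR/=.
rewrite !(linearDl, linearDr, linearNl, linearNr, linearZl_LR, linearZr_LR)/=.
have i2 := sqr_i R; rewrite conj_i.
set a := hdot (P x) (Q x); set b := hdot (P x) (Q y).
set c := hdot (P y) (Q x); set d := hdot (P y) (Q y).
have e : 4 * b = 2 * (b + c) + (- 'i%C ^+ 2) * (2 * (b - c)).
  by rewrite i2; ring.
rewrite e -[_ *: _]/(_ * _); ring.
Qed.

Context {I : countType} {L : I -> set H}.
Context (Phi Psi : forall i, bounded_op (L i)).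
Context (frame_cvg :
  forall x, cvg (partial_sum (frame_term Phi Psi x) @ totally)).

(** The hypothesis controls the form <Phi_i x, Psi_i y> on the diagonal only;
    polarization bounds its partial sums for all y, that is, bounds those of
    the vectors Psi_i^* (Phi_i x) weakly. *)
Lemma frame_op_cvg x :
  cvg (partial_sum (fun i => adjoint (Psi i) (Phi i x)) @ totally).
Proof.
apply: weakly_bounded_cvg => y.
have qb u := cvg_partial_sum_bounded _ (frame_cvg u).
have [C1 qC1] := qb (x + y); have [C2 qC2] := qb (x - y).
have [C3 qC3] := qb (x + 'i%C *: y); have [C4 qC4] := qb (x - 'i%C *: y).
exists (complex.Re ((C1 + C2 + (C3 + C4)) / 4)) => A.
set s := partial_sum _ A.
have s4 : 4 * hdot s y =
    partial_sum (frame_term Phi Psi (x + y)) A -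
    partial_sum (frame_term Phi Psi (x - y)) A +
    'i%C * (partial_sum (frame_term Phi Psi (x + 'i%C *: y)) A -
            partial_sum (frame_term Phi Psi (x - 'i%C *: y)) A).
  rewrite /s /partial_sum linear_sumlz mulr_sumr.
  rewrite -[X in _ = _ + _ * X]sumrB -[X in _ = X + _]sumrB mulr_sumr.
  rewrite -big_split.
  by apply: eq_bigr => i _; rewrite /= hdot_adjoint hdot_polarization.
have i1 : `|'i%C| = 1 :> R[i].
  by rewrite normc_def /= expr0n expr1n add0r sqrtr1.
have : `|hdot s y| <= (C1 + C2 + (C3 + C4)) / 4.
  rewrite ler_pdivlMr// mulrC -[X in X * _](@ger0_norm _ 4)// -normrM s4.
  apply: le_trans (ler_normD _ _) _; rewrite lerD// ?normrM ?i1 ?mul1r;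
  by apply: le_trans (ler_normB _ _) _; rewrite lerD.
move=> hs; rewrite -lecR; apply: le_trans (normc_ge_Re _) _.
by move/ger0_real/RRe_real: (le_trans (normr_ge0 _) hs) => ->.
Qed.

Lemma hdot_frame_op x :
  hdot (bi_g_frame_op Phi Psi x) x = sum (frame_term Phi Psi x).
Proof.
rewrite -sum_hdot; last exact: frame_op_cvg.
by congr (sum _); apply/funext => i; rewrite hdot_adjoint.
Qed.

End FrameOperator.

Theorem theorem3p11 (R : realType) (H : hilbertType R) (hH : separable H)
    (I : countType) (L : I -> set H) (hL : forall i, closed_subspace (L i))
    (K : bounded_op [set: H]) (Phi Psi : forall i, bounded_op (L i))
    (hPhiPsi : bi_g_frame Phi Psi) :
  K_bi_g_frame K Phi Psi <->
  exists A : R, 0 < A /\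
    op_ge (bi_g_frame_op Phi Psi) (fun x => A%:C *: K (adjoint K x)).
Proof.
have [A0 [B [A0_gt0 A0B frame]]] := hPhiPsi.
have frame_cvg x : cvg (partial_sum (frame_term Phi Psi x) @ totally).
  by have [] := frame x.
have KK A x : hdot (A%:C *: K (adjoint K x)) x = A%:C * `|adjoint K x| ^+ 2.
  by rewrite linearZl_LR /= adjointP hdot_norm.
split=> [[A [B' [A_gt0 _ Kframe]]]|[A [A_gt0 geA]]].
  exists A; split=> // x; rewrite KK hdot_frame_op//.
  by have [_ /andP[]] := Kframe x.
exists A, (Num.max A B); split=> //; first by rewrite le_max lexx.
move=> x; split=> //; apply/andP; split.
  by rewrite -KK -hdot_frame_op//; exact: geA.
have [_ /andP[_ upper]] := frame x; apply: le_trans upper _.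
by rewrite ler_wpM2r ?exprn_ge0// lecR le_max lexx orbT.
Qed.
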